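(* Let $G$ be a Hausdorff topological group, $K$ a subgroup of $G$, and $(X,\theta)$ a $K$-space. Then $G\times_K(X_K)$ and $G\times_KX$ are $G$-homeomorphic.
   Context: Partial actions. A partial action of a group $G$ (identity $e$) on a set $X$ is a map $\theta:G*X\to X$, $(g,x)\mapsto g\cdot x$, defined on a subset $G*X\subseteq G\times X$ (write $\exists\, g\cdot x$ for $(g,x)\in G*X$), such that for all $g,h\in G$, $x\in X$: (PA1) if $\exists\, g\cdot x$ then $\exists\, g^{-1}\cdot(g\cdot x)$ and $g^{-1}\cdot(g\cdot x)=x$; (PA2) if $\exists\, g\cdot(h\cdot x)$ then $\exists\,(gh)\cdot x$ and $g\cdot(h\cdot x)=(gh)\cdot x$; (PA3) $\exists\, e\cdot x$ and $e\cdot x=x$. It is global if $G*X=G\times X$. Put $X_g=\{x\in X:\exists\, g^{-1}\cdot x\}$, $\theta_g:X_{g^{-1}}\to X_g$, $x\mapsto g\cdot x$. If $G$ is a topological group and $X$ a topological space, $\theta$ is topological if every $X_g$ is open in $X$ and every $\theta_g$ is a homeomorphism, and continuous if $\theta$ is continuous for the subspace topology on $G*X\subseteq G\times X$. All topological groups are Hausdorff and all partial actions are topological. A $G$-space is a pair $(X,\theta)$ with $\theta$ a continuous (topological) partial action of $G$ on the topological space $X$. A $G$-map $f:(X,\theta)\to(Y,\eta)$ is a continuous map such that for all $(g,x)\in G*X$ one has $(g,f(x))\in G*Y$ and $\eta(g,f(x))=f(\theta(g,x))$; it is a $G$-homeomorphism if it is a homeomorphism whose inverse is also a $G$-map, and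 then the spaces are called $G$-homeomorphic. Twisted product. For a subgroup $K\le G$ (subspace topology) and a $K$-space $(X,\theta)$, $G\times_KX$ is the quotient space of $G\times X$ by the equivalence relation whose classes are $[g,x]_K=\{(gk^{-1},\theta(k,x)):k\in K^x\}$, where $K^x=\{k\in K:(k,x)\in K*X\}$. The group $G$ acts on it globally and continuously by $g'\cdot[g,x]_K=[g'g,x]_K$. Enveloping space. For a $K$-space $(X,\theta)$, $X_K=(K\times X)/R$ with the quotient topology, where $(g,x)R(h,y)$ iff $x\in X_{g^{-1}h}$ and $\theta_{h^{-1}g}(x)=y$; the class of $(g,x)$ is $[g,x]$. $K$ acts on $X_K$ globally and continuously by $k\cdot[h,x]=[kh,x]$; with this action $X_K$ is a $K$-space, so $G\times_K(X_K)$ is defined. *)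

(* Defs.v *)
From HB Require Import structures.
From mathcomp Require Import all_boot.
From mathcomp Require Import boolp classical_sets functions topology.

Set Implicit Arguments.
Unset Strict Implicit.
Unset Printing Implicit Defensive.

Local Open Scope classical_set_scope.
Local Open Scope quotient_scope.
Local Open Scope group_scope.

Lemma pair_continuous_at (T U V : topologicalType) (f : T -> U) (h : T -> V) x :
  {for x, continuous f} -> {for x, continuous h} ->
  {for x, continuous (fun y => (f y, h y))}.
Proof. by move=> fC hC; apply: (cvg_pair fC hC). Qed.

(* The Hausdorff condition is not part of the structure. *)
HB.mixin Record Group_isTopological G of Group G & Topological G := {
  mulg_continuous : continuous (fun gh : G * G => gh.1 * gh.2);
  invg_continuous : continuous (fun g : G => g^-1)
}.

#[short(type="topGroupType")]
HB.structure Definition TopGroup :=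
  {G of Group_isTopological G & Group G & Topological G}.

Record subgroup (G : groupType) := Subgroup {
  subgroup_set :> set G;
  subgroup1 : subgroup_set 1;
  subgroupM : forall g h,
    subgroup_set g -> subgroup_set h -> subgroup_set (g * h);
  subgroupV : forall g, subgroup_set g -> subgroup_set g^-1
}.

Section SubgroupGroup.
Variables (G : groupType) (K : subgroup G).

Definition subgroup_one : set_type K := SigSub (mem_set (subgroup1 K)).

Definition subgroup_mul (g h : set_type K) : set_type K :=
  SigSub (mem_set (subgroupM (set_valP g) (set_valP h))).

Definition subgroup_inv (g : set_type K) : set_type K :=
  SigSub (mem_set (subgroupV (set_valP g))).

Lemma subgroup_mulA : associative subgroup_mul.
Proof. by move=> g h k; apply/val_inj/mulgA. Qed.

Lemma subgroup_mul1 : left_id subgroup_one subgroup_mul.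
Proof. by move=> g; apply/val_inj/mul1g. Qed.

Lemma subgroup_mulr1 : right_id subgroup_one subgroup_mul.
Proof. by move=> g; apply/val_inj/mulg1. Qed.

Lemma subgroup_mulV : left_inverse subgroup_one subgroup_inv subgroup_mul.
Proof. by move=> g; apply/val_inj/mulVg. Qed.

Lemma subgroup_mulrV : right_inverse subgroup_one subgroup_inv subgroup_mul.
Proof. by move=> g; apply/val_inj/mulgV. Qed.

(* The type [set_type K] already carries the subspace topology. *)
HB.instance Definition _ := isGroup.Build (set_type K) subgroup_mulA
  subgroup_mul1 subgroup_mulr1 subgroup_mulV subgroup_mulrV.

End SubgroupGroup.

Section SubgroupTopology.
Variables (G : topGroupType) (K : subgroup G).

Lemma subgroup_val_continuous : continuous (val : set_type K -> G).
Proof. exact: (@initial_continuous _ _ (val : set_type K -> G)). Qed.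

Lemma subgroup_mulg_continuous :
  continuous (fun gh : set_type K * set_type K => gh.1 * gh.2).
Proof.
apply: (@continuous_comp_initial _ _ _ (val : set_type K -> G)) => -[g h].
rewrite (_ : _ \o _ = (fun gh : G * G => gh.1 * gh.2) \o
  (fun gh : set_type K * set_type K => (val gh.1, val gh.2))); last first.
  by apply/funext => gh.
apply: continuous_comp; last exact: mulg_continuous.
apply: cvg_pair; apply: continuous_comp => //=.
- exact: cvg_fst.
- exact: subgroup_val_continuous.
- exact: cvg_snd.
- exact: subgroup_val_continuous.
Qed.

Lemma subgroup_invg_continuous : continuous (fun g : set_type K => g^-1).
Proof.
apply: (@continuous_comp_initial _ _ _ (val : set_type K -> G)) => g.
rewrite (_ : _ \o _ = (fun g : G => g^-1) \o val); last first.
  by apply/funext.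
apply: continuous_comp; first exact: subgroup_val_continuous.
exact: invg_continuous.
Qed.

HB.instance Definition _ := Group_isTopological.Build (set_type K)
  subgroup_mulg_continuous subgroup_invg_continuous.

End SubgroupTopology.

(* A partial map on [D] is represented by a total one, whose values outside   *)
(* of [D] are irrelevant; [D (g, x)] reads "g . x is defined".                *)
Record partial_action (G : groupType) (X : Type) (D : set (G * X))
    (theta : G -> X -> X) : Prop := PartialAction {
  pactV : forall g x, D (g, x) ->
    D (g^-1, theta g x) /\ theta g^-1 (theta g x) = x;
  pactM : forall g h x, D (h, x) -> D (g, theta h x) ->
    D (g * h, x) /\ theta g (theta h x) = theta (g * h) x;
  pact1 : forall x, D (1, x) /\ theta 1 x = x
}.

(* The set X_g, i.e. the codomain of theta_g. *)
Definition pact_codom (G : groupType) (X : Type) (D : set (G * X)) (g : G)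
  : set X := [set x | D (g^-1, x)].

Definition homeo_between (X Y : topologicalType) (A : set X) (B : set Y)
    (f : X -> Y) : Prop :=
  exists f' : Y -> X,
    [/\ {homo f : x / A x >-> B x}, {homo f' : y / B y >-> A y},
        (forall x, A x -> f' (f x) = x) & (forall y, B y -> f (f' y) = y)] /\
    {within A, continuous f} /\ {within B, continuous f'}.

Definition topological_pact (G : groupType) (X : topologicalType)
    (D : set (G * X)) (theta : G -> X -> X) : Prop :=
  (forall g, open (pact_codom D g)) /\
  (forall g, homeo_between (pact_codom D g^-1) (pact_codom D g) (theta g)).

Definition continuous_pact (G : topGroupType) (X : topologicalType)
    (D : set (G * X)) (theta : G -> X -> X) : Prop :=
  {within D, continuous (fun gx : G * X => theta gx.1 gx.2)}.

Record gspace (G : topGroupType) := GSpace {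
  gspace_space :> topologicalType;
  gdom : set (G * gspace_space);
  gact : G -> gspace_space -> gspace_space;
  gspace_pact : partial_action gdom gact;
  gspace_topological : topological_pact gdom gact;
  gspace_continuous : continuous_pact gdom gact
}.

Arguments gdom {G} _ _.
Arguments gact {G} _ _ _.

Definition gmap (G : topGroupType) (X Y : gspace G) (f : X -> Y) : Prop :=
  continuous f /\
  forall g x, gdom X (g, x) ->
    gdom Y (g, f x) /\ gact Y g (f x) = f (gact X g x).

Definition ghomeomorphic (G : topGroupType) (X Y : gspace G) : Prop :=
  exists (f : X -> Y) (f' : Y -> X),
    [/\ cancel f f', cancel f' f, gmap f & gmap f'].

Section Translation.
Variables (G : topGroupType) (X : topologicalType) (e : equiv_rel (G * X)%type).
Hypothesis e_translate :
  forall g p q, e p q -> e (g * p.1, p.2) (g * q.1, q.2).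
Hypothesis e_open : forall U : set (G * X), open U ->
  open [set q | exists2 p, U p & e p q].

Local Notation Q := (quotient_topology {eq_quot e}).

(* Given by g' . [g, x] = [g' g, x]; see [translateE]. *)
Definition translate (g : G) (c : Q) : Q :=
  \pi_Q (g * (repr c).1, (repr c).2).

Lemma piQP p q : reflect (\pi_Q p = \pi_Q q) (e p q).
Proof. exact: (@eqmodP _ e p q). Qed.

Lemma translateE g p : translate g (\pi_Q p) = \pi_Q (g * p.1, p.2).
Proof.
by rewrite /translate; apply/piQP/e_translate/piQP; rewrite reprK.
Qed.

Lemma translate_pact : partial_action setT translate.
Proof.
have tM g h c : translate g (translate h c) = translate (g * h) c.
  by rewrite -[c]reprK !translateE /= mulgA reprK.
have t1 c : translate 1 c = c.
  by rewrite -[c]reprK translateE mul1g -surjective_pairing.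
split=> [g c _|g h c _ _|c]; split=> //.
by rewrite tM mulVg t1.
Qed.

Lemma translate_continuous :
  continuous (fun gc : G * Q => translate gc.1 gc.2).
Proof.
move=> [g c] W /=; rewrite -[c]reprK translateE.
set p := repr c => Wgp.
pose m (x : G * (G * X)) : Q := \pi_Q (x.1 * x.2.1, x.2.2).
have mC : continuous m.
  move=> x; apply: (@continuous_comp _ _ _
    (fun x : G * (G * X) => (x.1 * x.2.1, x.2.2)) (\pi_Q)); last first.
    exact: pi_continuous.
  apply: cvg_pair => /=.
    apply: (@continuous_comp _ _ _ (fun x : G * (G * X) => (x.1, x.2.1))
      (fun gh : G * G => gh.1 * gh.2)); last exact: mulg_continuous.
    apply: cvg_pair; first exact: cvg_fst.
    by apply: (@continuous_comp _ _ _ snd fst); [exact: cvg_snd|exact: cvg_fst].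
  by apply: (@continuous_comp _ _ _ snd snd); exact: cvg_snd.
have [[A B] /= [Ag Bp] sAB] := mC (g, p) W Wgp.
pose pi : G * X -> Q := \pi_Q.
have piB : nbhs (pi p) (pi @` B).
  rewrite nbhsE; exists (pi @` B°); last first.
    by apply: image_subset; exact: interior_subset.
  split; last by exists p.
  rewrite /open /= /quotient_open.
  rewrite (_ : _ @^-1` _ = [set q | exists2 p, B° p & e p q]).
    exact/e_open/open_interior.
  by apply/seteqP; split=> q [r Br rq]; exists r => //; apply/piQP.
exists (A, pi @` B) => //=.
move=> [h d] [/= Ah [q Bq <-]]; rewrite translateE.
exact: (sAB (h, q)).
Qed.

Lemma translate_topological : topological_pact setT translate.
Proof.
have tC g : continuous (translate g).
  move=> c; apply: (@continuous_comp _ _ _ (fun c : Q => (g, c))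
    (fun gc : G * Q => translate gc.1 gc.2)); last exact: translate_continuous.
  by apply: pair_continuous_at; [exact: cst_continuous|exact: cvg_id].
have [tV _ _] := translate_pact.
split=> g; first exact: openT.
exists (translate g^-1); split; last by split; exact: continuous_subspaceT.
split=> // [c _|c _]; first by case: (tV g c).
by case: (tV g^-1 c) => // _; rewrite invgK.
Qed.

Definition translation_gspace : gspace G :=
  GSpace translate_pact translate_topological
    (continuous_subspaceT translate_continuous).

End Translation.

(* For a group morphism iota : H -> G and a partial action of H on X, the     *)
(* orbit relation of k . (g, x) = (g (iota k)^-1, theta k x) on G x X.        *)
Section OrbitRelation.
Variables (G H : topGroupType) (iota : H -> G) (X : gspace H).
Hypothesis iotaM : {morph iota : g h / g * h}.

Let orb (p q : G * X) : Prop := exists k : H,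
  gdom X (k, p.2) /\ q = (p.1 * (iota k)^-1, gact X k p.2).

Let iota1 : iota 1 = 1.
Proof. by apply: (@mulgI _ (iota 1)); rewrite -iotaM !mulg1. Qed.

Let iotaV k : iota k^-1 = (iota k)^-1.
Proof. by apply: (@mulgI _ (iota k)); rewrite -iotaM !mulgV iota1. Qed.

Lemma orb_refl p : orb p p.
Proof.
have [D1 E1] := pact1 (gspace_pact X) p.2.
by exists 1; split=> //; rewrite E1 iota1 invg1 mulg1 -surjective_pairing.
Qed.

Lemma orb_sym p q : orb p q -> orb q p.
Proof.
move=> [k [Dk ->]] /=; have [DV EV] := pactV (gspace_pact X) Dk.
by exists k^-1; split=> //=; rewrite EV iotaV invgK mulgVK -surjective_pairing.
Qed.

Lemma orb_trans q p r : orb p q -> orb q r -> orb p r.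
Proof.
move=> [k [Dk ->]] [l /= [Dl ->]].
have [DM EM] := pactM (gspace_pact X) Dk Dl.
by exists (l * k); split=> //; rewrite EM iotaM invgM mulgA.
Qed.

Lemma orb_translate g p q : orb p q -> orb (g * p.1, p.2) (g * q.1, q.2).
Proof. by move=> [k [Dk ->]]; exists k; split; rewrite //= mulgA. Qed.

Lemma orb_open (U : set (G * X)) : open U ->
  open [set q | exists2 p, U p & orb p q].
Proof.
move=> oU; rewrite openE => q [p Up /orb_sym[k [Dk pE]]].
have [opX homX] := gspace_topological X.
have [_ [_ [thC _]]] := homX k.
have codE : pact_codom (gdom X) k^-1 q.2 by rewrite /pact_codom /= invgK.
have {}thC : {for q.2, continuous (gact X k)}.
  by move: thC; rewrite continuous_open_subspace// => /(_ q.2); apply; rewrite inE.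
pose psi (x : G * X) : G * X := (x.1 * (iota k)^-1, gact X k x.2).
have psiC : {for q, continuous psi}.
  apply: cvg_pair => /=.
    apply: (@continuous_comp _ _ _ (fun x : G * X => (x.1, (iota k)^-1))
      (fun gh : G * G => gh.1 * gh.2)); last exact: mulg_continuous.
    by apply: cvg_pair; [exact: cvg_fst|exact: cvg_cst].
  by apply: (@continuous_comp _ _ _ snd (gact X k)); first exact: cvg_snd.
have nU : nbhs q (psi @^-1` U).
  by apply: psiC; apply: open_nbhs_nbhs; split=> //; rewrite /psi -pE.
have nD : nbhs q (snd @^-1` pact_codom (gdom X) k^-1).
  have /= := @cvg_snd _ _ (nbhs q.1) (nbhs q.2) _; apply.
  exact: open_nbhs_nbhs.
apply: filterS2 nU nD => r Ur Dr; exists (psi r) => //.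
apply: orb_sym; exists k; split=> //.
by move: Dr; rewrite /= /pact_codom /= invgK.
Qed.

End OrbitRelation.

Section TwistedProduct.
Variables (G : topGroupType) (K : subgroup G) (X : gspace (set_type K)).

Definition twisted_rel : rel (G * X) := fun p q =>
  `[< exists k : set_type K,
        gdom X (k, p.2) /\ q = (p.1 * (val k)^-1, gact X k p.2) >].

Let valK : {morph (val : set_type K -> G) : g h / g * h}.
Proof. by []. Qed.

Lemma twisted_rel_refl : reflexive twisted_rel.
Proof. by move=> p; apply/asboolP/(orb_refl valK). Qed.

Lemma twisted_rel_sym : symmetric twisted_rel.
Proof.
by move=> p q; apply/idP/idP => /asboolP pq; apply/asboolP/(orb_sym valK).
Qed.

Lemma twisted_rel_trans : transitive twisted_rel.
Proof.
by move=> q p r /asboolP pq /asboolP qr; apply/asboolP/(orb_trans valK pq qr).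
Qed.

Canonical twisted_equiv :=
  EquivRel twisted_rel twisted_rel_refl twisted_rel_sym twisted_rel_trans.

Lemma twisted_translate g p q :
  twisted_equiv p q -> twisted_equiv (g * p.1, p.2) (g * q.1, q.2).
Proof. by move=> /asboolP pq; apply/asboolP/orb_translate. Qed.

Lemma twisted_open (U : set (G * X)) : open U ->
  open [set q | exists2 p, U p & twisted_equiv p q].
Proof.
move=> /(orb_open valK); congr open; apply/seteqP.
by split=> q [p Up pq]; exists p => //; apply/asboolP.
Qed.

Definition twisted_product : gspace G :=
  translation_gspace twisted_translate twisted_open.

End TwistedProduct.

Section Envelope.
Variables (K : topGroupType) (X : gspace K).

Definition envelope_rel : rel (K * X) := fun p q =>
  `[< pact_codom (gdom X) (p.1^-1 * q.1) p.2 /\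
      gact X (q.1^-1 * p.1) p.2 = q.2 >].

Let idK : {morph (id : K -> K) : g h / g * h}. Proof. by []. Qed.

Lemma envelope_relP p q : reflect (exists k : K,
  gdom X (k, p.2) /\ q = (p.1 * k^-1, gact X k p.2)) (envelope_rel p q).
Proof.
apply: (iffP (asboolP _)) => [|[k [Dk ->]]] /=; rewrite /pact_codom /= invgM invgK.
  move=> [D E]; exists (q.1^-1 * p.1); split=> //.
  by rewrite E invgM invgK mulgA mulgV mul1g -surjective_pairing.
by rewrite invgM invgK mulgVK.
Qed.

Lemma envelope_rel_refl : reflexive envelope_rel.
Proof. by move=> p; apply/envelope_relP/(orb_refl idK). Qed.

Lemma envelope_rel_sym : symmetric envelope_rel.
Proof.
by move=> p q; apply/idP/idP => /envelope_relP pq;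
  apply/envelope_relP/(orb_sym idK).
Qed.

Lemma envelope_rel_trans : transitive envelope_rel.
Proof.
move=> q p r /envelope_relP pq /envelope_relP qr.
exact/envelope_relP/(orb_trans idK pq qr).
Qed.

Canonical envelope_equiv :=
  EquivRel envelope_rel envelope_rel_refl envelope_rel_sym envelope_rel_trans.

Lemma envelope_translate g p q :
  envelope_equiv p q -> envelope_equiv (g * p.1, p.2) (g * q.1, q.2).
Proof.
by move=> /envelope_relP pq; apply/envelope_relP/(@orb_translate _ _ id).
Qed.

Lemma envelope_open (U : set (K * X)) : open U ->
  open [set q | exists2 p, U p & envelope_equiv p q].
Proof.
move=> /(orb_open idK); congr open; apply/seteqP.
by split=> q [p Up pq]; exists p => //; apply/envelope_relP.
Qed.

Definition envelope : gspace K :=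
  translation_gspace envelope_translate envelope_open.

End Envelope.

(* Main.v *)
(* The homeomorphism is [[g, [k, x]] |-> [g k, x]], with inverse
   [[g, x] |-> [g, [1, x]]].  Continuity of the former rests on the openness of
   the projection [K x X -> X_K], by which [G x (K x X) -> G x X_K] is a
   quotient map. *)
Require Import Defs.
From mathcomp Require Import all_boot.
From mathcomp Require Import boolp classical_sets functions topology.

Set Implicit Arguments.
Unset Strict Implicit.
Unset Printing Implicit Defensive.

Local Open Scope classical_set_scope.
Local Open Scope quotient_scope.
Local Open Scope group_scope.

Section OpenQuotient.
Variables (T : topologicalType) (e : equiv_rel T).
Local Notation Q := (quotient_topology {eq_quot e}).

Lemma eq_quot_piP p q : reflect (\pi_Q p = \pi_Q q) (e p q).
Proof. exact: (@eqmodP _ e p q). Qed.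

Lemma eq_quot_continuous (Z : topologicalType) (f : Q -> Z) :
  continuous (fun p => f (\pi_Q p)) -> continuous f.
Proof. by move=> fC; apply/quotient_continuous. Qed.

Hypothesis e_open : forall U : set T, open U ->
  open [set q | exists2 p, U p & e p q].

(** The projection is open: the preimage of the image of the interior of [B] is its saturation,
    which is open by [e_open]. *)
Lemma eq_quot_pi_nbhs p (B : set T) :
  nbhs p B -> nbhs (\pi_Q p) ((\pi_Q : T -> Q) @` B).
Proof.
move=> Bp; rewrite nbhsE; exists ((\pi_Q : T -> Q) @` B°); last first.
  by apply: image_subset; exact: interior_subset.
split; last by exists p.
rewrite /open /= /quotient_open.
rewrite (_ : _ @^-1` _ = [set q | exists2 p, B° p & e p q]).
  exact/e_open/open_interior.
by apply/seteqP; split=> q [r Br rq]; exists r => //; apply/eq_quot_piP.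
Qed.

(** The product of an identity with a quotient map need not be a quotient map. Here openness of the
    projection sends a box around [(s, repr c)] to a neighbourhood of [(s, c)]. *)
Lemma eq_quot_prod_continuous (S Z : topologicalType) (f : S * Q -> Z) :
  continuous (fun sp : S * T => f (sp.1, \pi_Q sp.2)) -> continuous f.
Proof.
move=> fC [s c] W; rewrite -[c]reprK => /(fC (s, repr c)).
move=> [[A B] /= [As Bp] sAB].
exists (A, (\pi_Q : T -> Q) @` B); first by split=> //; exact: eq_quot_pi_nbhs.
by move=> [t d] [/= At [q Bq <-]]; exact: (sAB (t, q)).
Qed.

End OpenQuotient.

Section TwistedEnvelope.
Variables (G : topGroupType) (K : subgroup G) (X : gspace (set_type K)).

Local Notation E := (quotient_topology {eq_quot (envelope_equiv X)}).
Local Notation P := (quotient_topology {eq_quot (twisted_equiv X)}).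
Local Notation PE :=
  (quotient_topology {eq_quot (twisted_equiv (envelope X))}).

Lemma twisted_product_eq (k : set_type K) g x : gdom X (k, x) ->
  \pi_P (g * (val k)^-1, gact X k x) = \pi_P (g, x).
Proof.
by move=> Dk; apply/esym/eq_quot_piP/asboolP; exists k.
Qed.

Lemma envelope_eq (k h : set_type K) x : gdom X (k, x) ->
  \pi_E (h * k^-1, gact X k x) = \pi_E (h, x).
Proof.
by move=> Dk; apply/esym/eq_quot_piP/envelope_relP; exists k.
Qed.

(** [K] acts globally on the envelope, so any [k] can be moved across, whether or not [k . x] is
    defined in [X]. *)
Lemma twisted_envelope_eq (k h : set_type K) g x :
  \pi_PE (g * (val k)^-1, \pi_E (k * h, x)) = \pi_PE (g, \pi_E (h, x)).
Proof.
apply/esym/eq_quot_piP/asboolP; exists k; split=> //=.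
by rewrite (translateE (@envelope_translate _ X)).
Qed.

(** Separated from [twisted_absorb] so that independence of the inner and of the outer
    representative is checked one layer at a time. *)
Definition twisted_absorb_pair (gc : G * E) : P :=
  \pi_P (gc.1 * val (repr gc.2).1, (repr gc.2).2).

Definition twisted_absorb (c : PE) : P := twisted_absorb_pair (repr c).

Definition twisted_unabsorb (c : P) : PE :=
  \pi_PE ((repr c).1, \pi_E (1, (repr c).2)).

(** Another representative of [[k, x]] is [(k l^-1, l . x)], and [[g k l^-1, l . x] = [g k, x]] in
    the twisted product. *)
Lemma twisted_absorb_pairE g (k : set_type K) x :
  twisted_absorb_pair (g, \pi_E (k, x)) = \pi_P (g * val k, x).
Proof.
rewrite /twisted_absorb_pair /=; set p := repr _.
have /envelope_relP[l [/= Dl ->]] : envelope_rel (k, x) p.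
  by apply/eq_quot_piP; rewrite reprK.
by rewrite /= mulgA; exact: twisted_product_eq.
Qed.

(** Another outer representative is [(g l^-1, [l k, x])], and the two factors [l] cancel in the
    product. *)
Lemma twisted_absorbE g (k : set_type K) x :
  twisted_absorb (\pi_PE (g, \pi_E (k, x))) = \pi_P (g * val k, x).
Proof.
rewrite /twisted_absorb; set p := repr _.
have /asboolP[l [/= _ ->]] : @twisted_rel G K (envelope X) (g, \pi_E (k, x)) p.
  by apply/eq_quot_piP; rewrite reprK.
rewrite (translateE (@envelope_translate _ X)) twisted_absorb_pairE /=.
by rewrite mulgA mulgVK.
Qed.

Lemma twisted_unabsorbE g x :
  twisted_unabsorb (\pi_P (g, x)) = \pi_PE (g, \pi_E (1, x)).
Proof.
rewrite /twisted_unabsorb; set p := repr _.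
have /asboolP[k [/= Dk ->]] : twisted_rel (g, x) p.
  by apply/eq_quot_piP; rewrite reprK.
(* The right-hand side becomes [[g k^-1, [k, x]]], and then [[k, x] = [k k^-1, k . x] =
   [1, k . x]]. *)
rewrite -[RHS](twisted_envelope_eq k) mulg1.
by rewrite -(envelope_eq k Dk) mulgV.
Qed.

Lemma twisted_envelope_ind (S : PE -> Prop) :
  (forall g k x, S (\pi_PE (g, \pi_E (k, x)))) -> forall c, S c.
Proof.
move=> H c; rewrite -[c]reprK; case: (repr c) => g d.
by rewrite -[d]reprK; case: (repr d) => k x; exact: H.
Qed.

Lemma twisted_product_ind (S : P -> Prop) :
  (forall g x, S (\pi_P (g, x))) -> forall c, S c.
Proof. by move=> H c; rewrite -[c]reprK; case: (repr c) => g x; exact: H. Qed.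

Lemma twisted_absorbK : cancel twisted_absorb twisted_unabsorb.
Proof.
apply: twisted_envelope_ind => g k x.
rewrite twisted_absorbE twisted_unabsorbE.
(* Moving [k] across turns [[g k, [1, x]]] into [[g, [k, x]]]. *)
by rewrite -(twisted_envelope_eq k) mulgK mulg1.
Qed.

Lemma twisted_unabsorbK : cancel twisted_unabsorb twisted_absorb.
Proof.
apply: twisted_product_ind => g x.
by rewrite twisted_unabsorbE twisted_absorbE mulg1.
Qed.

Lemma twisted_absorb_continuous : continuous twisted_absorb.
Proof.
(* The outer quotient is removed by its universal property, the inner one, a factor of a product, by
   openness. *)
apply: eq_quot_continuous; apply: (eq_quot_prod_continuous (@envelope_open _ X)).
rewrite (_ : (fun _ => _) = (fun p : G * (set_type K * X) =>
    \pi_P (p.1 * val p.2.1, p.2.2))); last first.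
  by apply/funext => -[g [k x]]; exact: twisted_absorbE.
move=> p; apply: (@continuous_comp _ _ _
  (fun p : G * (set_type K * X) => (p.1 * val p.2.1, p.2.2)) (\pi_P)); last first.
  exact: pi_continuous.
apply: pair_continuous_at; last first.
  by apply: (@continuous_comp _ _ _ snd snd); exact: cvg_snd.
apply: (@continuous_comp _ _ _ (fun p : G * (set_type K * X) => (p.1, val p.2.1))
  (fun gh : G * G => gh.1 * gh.2)); last exact: mulg_continuous.
apply: pair_continuous_at; first exact: cvg_fst.
apply: (@continuous_comp _ _ _ (fun p : G * (set_type K * X) => p.2.1) val).
  by apply: (@continuous_comp _ _ _ snd fst); [exact: cvg_snd|exact: cvg_fst].
exact: subgroup_val_continuous.
Qed.

Lemma twisted_unabsorb_continuous : continuous twisted_unabsorb.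
Proof.
apply: eq_quot_continuous.
rewrite (_ : (fun _ => _) = (fun p : G * X => \pi_PE (p.1, \pi_E (1, p.2))));
  last by apply/funext => -[g x]; exact: twisted_unabsorbE.
move=> p; apply: (@continuous_comp _ _ _
  (fun p : G * X => (p.1, \pi_E (1, p.2)) : G * E) (\pi_PE)); last first.
  exact: pi_continuous.
apply: pair_continuous_at; first exact: cvg_fst.
apply: (@continuous_comp _ _ _
  (fun p : G * X => (1, p.2) : set_type K * X) (\pi_E)); last first.
  exact: pi_continuous.
by apply: pair_continuous_at; [exact: cvg_cst|exact: cvg_snd].
Qed.

(** [G] multiplies the first coordinate on the left and absorption multiplies it on the right, so
    the two commute. *)
Lemma twisted_absorb_translate g c :
  gact (twisted_product X) g (twisted_absorb c) =
  twisted_absorb (gact (twisted_product (envelope X)) g c).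
Proof.
move: c; apply: twisted_envelope_ind => h k x /=.
rewrite (translateE (@twisted_translate _ _ (envelope X))) !twisted_absorbE.
by rewrite (translateE (@twisted_translate _ _ X)) /= mulgA.
Qed.

End TwistedEnvelope.

Theorem proposition3p4 (G : topGroupType) (G_hausdorff : hausdorff_space G)
    (K : subgroup G) (X : gspace (set_type K)) :
  ghomeomorphic (twisted_product (envelope X)) (twisted_product X).
Proof.
exists (@twisted_absorb G K X), (@twisted_unabsorb G K X).
split; [exact: twisted_absorbK|exact: twisted_unabsorbK| |].
  split; first exact: twisted_absorb_continuous.
  by move=> g c _; split=> //; exact: twisted_absorb_translate.
split; first exact: twisted_unabsorb_continuous.
move=> g c _; split=> //.
(* Equivariance of the inverse follows by applying the injective equivariant map [twisted_absorb] to
   both sides. *)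
apply: (can_inj (@twisted_absorbK G K X)).
by rewrite -twisted_absorb_translate !twisted_unabsorbK.
Qed.
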